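(* Let $n\ge3$ be an integer. There is a constant $C=C(n)>0$ depending only on $n$ such that for every real $\epsilon>2/n$ and every real $T\ge1$, $$\frac{1}{N(T)}\sum_{A\in Q(T)}\ \max_{\boldsymbol c\in\mathbb{Q}^n,\ \boldsymbol c\ne\boldsymbol 0}\frac{\mathrm{Gap}_{\boldsymbol c}(A)}{\|A\|_\infty^{\epsilon}\|\boldsymbol c\|_1}\le C .$$
   Context: For $A=(a_1,\ldots,a_n)\in\mathbb{Z}^{1\times n}$ with positive entries, $b\in\mathbb{Z}$ and $\boldsymbol c\in\mathbb{Q}^n$, let $IP_{\boldsymbol c}(A,b)=\min\{\boldsymbol c\cdot\boldsymbol x: A\boldsymbol x=b,\ \boldsymbol x\in\mathbb{Z}^n_{\ge0}\}$ and $LP_{\boldsymbol c}(A,b)=\min\{\boldsymbol c\cdot\boldsymbol x: A\boldsymbol x=b,\ \boldsymbol x\in\mathbb{R}^n_{\ge0}\}$. When the integer problem is feasible and bounded, $IG_{\boldsymbol c}(A,b)=IP_{\boldsymbol c}(A,b)-LP_{\boldsymbol c}(A,b)$. The integer programming gap is $\mathrm{Gap}_{\boldsymbol c}(A)=\max_b IG_{\boldsymbol c}(A,b)$, where $b$ ranges over all integers for which the integer problem is feasible and bounded. $\|A\|_\infty=\max_i|a_i|$ and $\|\boldsymbol c\|_1=\sum_i|c_i|$. For $T\ge1$ let $Q(T)$ be the set of all $A=(a_1,\ldots,a_n)\in\mathbb{Z}^{1\times n}$ with all $a_i>0$, $\gcd(a_1,\ldots,a_n)=1$ and $\|A\|_\infty\le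 T$, and let $N(T)=\#Q(T)$. *)

(* Defs.v *)
From mathcomp Require Import all_boot all_order all_algebra.
From mathcomp Require Import finmap.
From mathcomp Require Import all_classical all_reals all_analysis.

Set Implicit Arguments.
Unset Strict Implicit.
Unset Printing Implicit Defensive.

Import Order.TTheory GRing.Theory Num.Theory.

Local Open Scope classical_set_scope.
Local Open Scope ring_scope.

Definition cost (R : realType) (n : nat) (c : 'rV[rat]_n) (x : 'cV[R]_n) : R :=
  \sum_(i < n) ratr (c 0 i) * x i 0.

Definition norm1 (n : nat) (c : 'rV[rat]_n) : rat := \sum_(i < n) `|c 0 i|.

Definition norm_inf (n : nat) (A : 'rV[int]_n) : int :=
  \big[Num.max/0]_(i < n) `|A 0 i|.

Definition IP_points (n : nat) (A : 'rV[int]_n) (b : int) : set 'cV[int]_n :=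
  [set x | A *m x = b%:M /\ forall i, 0 <= x i 0].

Definition LP_points (R : realType) (n : nat) (A : 'rV[int]_n) (b : int) :
    set 'cV[R]_n :=
  [set x | map_mx intr A *m x = (b%:~R)%:M /\ forall i, 0 <= x i 0].

(* The minima and maxima below are infima and suprema in the extended reals.
   They agree with the minimum or maximum whenever it is attained, and an
   unbounded family of values has supremum +oo. *)
Definition IP (R : realType) (n : nat) (c : 'rV[rat]_n) (A : 'rV[int]_n)
    (b : int) : \bar R :=
  ereal_inf [set (cost c (map_mx intr x : 'cV[R]_n))%:E | x in IP_points A b].

Definition LP (R : realType) (n : nat) (c : 'rV[rat]_n) (A : 'rV[int]_n)
    (b : int) : \bar R :=
  ereal_inf [set (cost c x)%:E | x in (LP_points A b : set 'cV[R]_n)].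

Definition IP_feasible (n : nat) (A : 'rV[int]_n) (b : int) : Prop :=
  exists x, IP_points A b x.

Definition IP_bounded (R : realType) (n : nat) (c : 'rV[rat]_n)
    (A : 'rV[int]_n) (b : int) : Prop :=
  exists m : R, forall x, IP_points A b x -> m <= cost c (map_mx intr x).

(* Only meaningful when the integer problem is feasible and bounded. *)
Definition IG (R : realType) (n : nat) (c : 'rV[rat]_n) (A : 'rV[int]_n)
    (b : int) : \bar R :=
  (IP R c A b - LP R c A b)%E.

Definition Gap (R : realType) (n : nat) (c : 'rV[rat]_n) (A : 'rV[int]_n) :
    \bar R :=
  ereal_sup [set IG R c A b | b in
    [set b | IP_feasible A b /\ IP_bounded R c A b]].

Definition max_normalized_gap (R : realType) (n : nat) (eps : R)
    (A : 'rV[int]_n) : \bar R :=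
  ereal_sup [set (Gap R c A *
      (((norm_inf A)%:~R `^ eps * ratr (norm1 c))^-1)%:E)%E |
    c in [set c : 'rV[rat]_n | c != 0]].

Definition Q (R : realType) (n : nat) (T : R) : set 'rV[int]_n :=
  [set A : 'rV[int]_n | [/\ forall i, 0 < A 0 i,
               \big[gcdz/0]_(i < n) A 0 i = 1 &
               (norm_inf A)%:~R <= T]].

Arguments Q {R} n T.

Lemma finite_Q (R : realType) (n : nat) (T : R) : finite_set (Q n T).
Proof.
pose k := `|Num.floor T|%N.+1.
apply: (@sub_finite_set _ _
  ((fun f : {ffun 'I_n -> 'I_k} => \row_i (f i : nat)%:Z) @` setT)); last first.
  exact/finite_image/finite_finset.
move=> A [Apos _ AT]; have Ak i : (absz (A 0%R i) < k)%N.
  have h : A 0 i <= norm_inf A.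
    by rewrite (le_trans (ler_norm _))// (le_bigmax _ (fun j => `|A 0 j|)).
  have h1 : norm_inf A <= Num.floor T by rewrite floor_ge_int.
  rewrite /k ltnS -lez_nat gtz0_abs ?Apos// (le_trans h)//.
  by rewrite (le_trans h1)// lez_abs.
exists [ffun i => Ordinal (Ak i)] => //; apply/rowP => i.
by rewrite mxE ffunE/= gtz0_abs.
Qed.

(* [fset_set] and [\sum_(_ \in _)] are meaningful on finite sets only,
   whence [finite_Q]. *)
Definition N (R : realType) (n : nat) (T : R) : nat := #|` fset_set (Q n T)|.

(* Main.v *)
Require Import Defs.
From mathcomp Require Import all_boot all_order all_algebra.
From mathcomp Require Import finmap.
From mathcomp Require Import all_classical all_reals all_analysis.
From mathcomp Require Import complex.
From mathcomp Require Import zify ring lra.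
(* [all_classical] shadows lemmas on finite sets such as [subsetP]. *)
From mathcomp Require Import fintype finset.

(** If every residue modulo the smallest entry [m] of [A] is of the form
    [sum_j A_j y_j] with all [y_j <= Y], the sum being over the other [n - 1]
    entries, then every integer [b >= (n - 1) Y |A|] is representable, and the
    gap is at most [2 |c|_1 ((n - 1) Y + 1) |A| / m]. One may always take
    [Y = m - 1].

    A much smaller [Y], of order [K = m^(2/n)], works unless the entries of
    [A] resonate modulo [m]: some nonzero frequency [h] brings all the
    [h A_j mod m] within [U = m^(1 - 2/n)] of [0]. Indeed, without resonance,
    summing a Fejer kernel shows that no residue has many representations in
    the box [0, K)^(n-1), so that the box reaches a positive proportion of the
    residues, and boundedly many copies of it reach all of them. A union bound
    over [h] shows that the proportion of resonant [A] is [O(m^(2/n - 1))].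

    Resonant or not, the [A] with smallest entry [m] thus contribute on average
    [O(T m^(2/n - 1))], and summing over [m <= T] gives an average
    [O(T^(2/n))]. *)

Set Implicit Arguments.
Unset Strict Implicit.
Unset Printing Implicit Defensive.

Import Order.TTheory GRing.Theory Num.Theory.
Import numFieldNormedType.Exports.

Local Open Scope ring_scope.

(** * Equidistribution modulo m away from resonances *)

(* The circular distance from [h * a j] to 0 modulo [m] is less than [U] for
   all [j], stated without subtraction. *)
Definition resonant (d m U : nat) (a : 'I_d -> nat) : bool :=
  [exists h : 'I_m, (0 < h)%N && [forall j, [exists u : 'I_U, [exists v : 'I_U,
    (h * a j + u == v %[mod m])%N]]]].

(** Multiplication by [m.-1] serves as negation modulo [m], which keeps exponents of roots of unity
    natural. *)
Lemma eqn_mod_opp (m s r : nat) :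
  (0 < m)%N -> (m %| s + m.-1 * r)%N = (s == r %[mod m])%N.
Proof.
move=> m0.
have -> : (m %| s + m.-1 * r)%N = (s + m.-1 * r == r + m.-1 * r %[mod m])%N.
  rewrite /dvdn; congr (_ == _).
  by rewrite -mulSn prednK// modnMr.
by rewrite eqn_modDr.
Qed.

(** Orthogonality of characters: when [z ^+ t] is not 1, the geometric sum times [z ^+ t - 1] is
    [z ^+ (t * m) - 1 = 0]. *)
Lemma sum_expr_prim_root (F : fieldType) (m : nat) (z : F) (t : nat) :
  m.-primitive_root z ->
  \sum_(w < m) z ^+ (t * w) = (if (m %| t)%N then m%:R else 0).
Proof.
move=> zP; under eq_bigr do rewrite exprM.
case: ifPn => [|]; rewrite (prim_order_dvd zP).
  move=> /eqP ->; under eq_bigr do rewrite expr1n.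
  by rewrite sumr_const card_ord.
move=> zt; apply/eqP; have := subrX1 (z ^+ t) m.
rewrite -exprM mulnC exprM (prim_expr_order zP) expr1n subrr => /esym/eqP.
by rewrite mulf_eq0 subr_eq0 (negPf zt).
Qed.

(* [fejer] is the Fejer kernel |sum_(u < U) z ^ (u w)|^2, as z^-1 = z^(m-1). *)
Definition fejer (F : fieldType) (m U : nat) (z : F) (w : nat) : F :=
  \sum_(u < U) \sum_(v < U) z ^+ ((u + m.-1 * v) * w).

(** Fourier inversion: the congruence is detected by a sum over frequencies [h], after which the sum
    over [w] factors over [j]. Frequency 0 gives the right-hand side; for any other [h], the absence
    of resonance kills a factor. *)
Lemma sum_fejer (F : fieldType) (m U d : nat) (z : F) (a : 'I_d -> nat)
    (r : nat) :
  m.-primitive_root z -> (U <= m)%N -> ~~ resonant m U a ->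
  m%:R * (\sum_(w : {ffun 'I_d -> 'I_m} | (\sum_j a j * w j == r %[mod m])%N)
    \prod_j fejer m U z (w j)) = ((U * m) ^ d)%:R.
Proof.
move=> zP Um nres; have m0 := prim_order_gt0 zP.
(* The Fourier transform of the kernel at [h * a j]: [m] times the number of pairs [u], [v] with
   [h * a j + u] congruent to [v]. *)
pose G h j := \sum_(w < m) z ^+ (h * a j * w) * fejer m U z w.
have GE h j : G h j = \sum_(u < U) \sum_(v < U)
    (if (h * a j + u == v %[mod m])%N then m%:R else 0).
  rewrite /G; under eq_bigr do rewrite /fejer mulr_sumr.
  rewrite exchange_big; apply: eq_bigr => u _ /=.
  under eq_bigr do rewrite mulr_sumr.
  rewrite exchange_big; apply: eq_bigr => v _ /=.
  under eq_bigr do rewrite -exprD -mulnDl.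
  by rewrite sum_expr_prim_root// addnA eqn_mod_opp.
transitivity (\sum_(h < m) z ^+ (h * (m.-1 * r)) * \prod_j G h j).
  rewrite mulr_sumr big_mkcond /=.
  transitivity (\sum_(h < m) \sum_(w : {ffun 'I_d -> 'I_m})
      z ^+ (h * (m.-1 * r)) * \prod_j (z ^+ (h * a j * w j) * fejer m U z (w j))).
    rewrite exchange_big; apply: eq_bigr => w _ /=.
    under [RHS]eq_bigr => h _.
      rewrite big_split /= mulrA prodrXr.
      under eq_bigr do rewrite -mulnA.
      rewrite -big_distrr /= -exprD -mulnDr [(_ + _)%N]addnC [(h * _)%N]mulnC.
      over.
    rewrite -mulr_suml sum_expr_prim_root// eqn_mod_opp//.
    by case: ifP => // _; rewrite mul0r.
  by apply: eq_bigr => h _; rewrite -mulr_sumr /G bigA_distr_bigA.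
(* For [h = 0], since [U <= m], only the pairs with [u = v] count, so each factor is [U * m]. *)
rewrite (bigD1 (Ordinal m0)) //= mul0n expr0 mul1r [X in _ + X]big1 ?addr0.
  transitivity (\prod_(j < d) ((U * m)%:R : F)); last first.
    by rewrite prodr_const card_ord natrX.
  apply: eq_bigr => j _; rewrite GE.
  transitivity (\sum_(u < U) (m%:R : F)); last first.
    by rewrite sumr_const card_ord mulnC natrM mulr_natr.
  apply: eq_bigr => u _.
  rewrite mul0n add0n (bigD1 u) //= eqxx [X in _ + X]big1 ?addr0 // => v vu.
  rewrite !modn_small ?(leq_trans (ltn_ord _) Um)//.
  by rewrite eq_sym (inj_eq val_inj) (negPf vu).
move=> h h0; have hpos : (0 < h)%N by rewrite lt0n.
have [j /existsP hj] : exists j, ~~ [exists u : 'I_U, [exists v : 'I_U,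
    (h * a j + u == v %[mod m])%N]].
  apply/existsP; rewrite -negb_forall; apply: contra nres => H.
  by apply/existsP; exists h; rewrite hpos.
rewrite (bigD1 j) //=; suff -> : G h j = 0 by rewrite mul0r mulr0.
rewrite GE big1// => u _; rewrite big1// => v _.
by case: ifP => // H; case: hj; exists u; apply/existsP; exists v.
Qed.

Lemma norm_prim_root (C : numDomainType) (m : nat) (z : C) :
  m.-primitive_root z -> `|z| = 1.
Proof.
move=> zP; have m0 := prim_order_gt0 zP.
apply/eqP; rewrite -(pexpr_eq1 m0)// -normrX (prim_expr_order zP).
by rewrite normr1.
Qed.

Lemma norm_1BX_le (C : numDomainType) (z : C) (k : nat) :
  `|z| = 1 -> `|1 - z ^+ k| <= k%:R * `|1 - z|.
Proof.
move=> z1; elim: k => [|k IH]; first by rewrite expr0 subrr normr0 mul0r.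
have -> : 1 - z ^+ k.+1 = (1 - z ^+ k) + z ^+ k * (1 - z).
  by rewrite exprSr mulrBr mulr1 addrA subrK.
rewrite (le_trans (ler_normD _ _))// normrM normrX z1 expr1n mul1r.
by rewrite -natr1 mulrDl mul1r lerD2r.
Qed.

Lemma fejerE (C : numClosedFieldType) (m U : nat) (z : C) (w : nat) :
  m.-primitive_root z -> fejer m U z w = `|\sum_(u < U) z ^+ (u * w)| ^+ 2.
Proof.
move=> zP; have m0 := prim_order_gt0 zP; have z1 := norm_prim_root zP.
have zV : z ^+ m.-1 = z^*.
  have z0 : z != 0 by rewrite -normr_gt0 z1.
  apply: (mulfI z0); rewrite -normCK z1 expr1n -exprS prednK//.
  exact: prim_expr_order.
rewrite normCK rmorph_sum mulr_suml; apply: eq_bigr => u _ /=.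
rewrite mulr_sumr; apply: eq_bigr => v _.
by rewrite mulnDl exprD -mulnA [z ^+ (m.-1 * _)]exprM zV rmorphXn.
Qed.

(** Each [z ^+ (u * w)] is within [8 u w / m <= 1 / 2] of 1, so the sum of these [U] terms has
    modulus at least [U / 2]. *)
Lemma fejer_ge (C : numClosedFieldType) (m U K : nat) (z : C) (w : nat) :
  m.-primitive_root z -> `|1 - z| <= 8 / m%:R ->
  (16 * (U.-1 * K.-1) <= m)%N -> (w < K)%N ->
  (U%:R / 2) ^+ 2 <= fejer m U z w.
Proof.
move=> zP z8 UK wK; have m0 := prim_order_gt0 zP; have z1 := norm_prim_root zP.
have mR : 0 < (m%:R : C) by rewrite ltr0n.
rewrite (fejerE _ _ zP) lerXn2r ?nnegrE ?divr_ge0 ?ler0n//.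
set D := \sum_(u < U) _.
have UD : `|U%:R - D| <= U%:R / 2.
  have -> : U%:R - D = \sum_(u < U) (1 - z ^+ (u * w)).
    by rewrite sumrB sumr_const card_ord.
  rewrite (le_trans (ler_norm_sum _ _ _))//.
  apply: (@le_trans _ _ (\sum_(u < U) (2^-1 : C))); last first.
    by rewrite sumr_const card_ord mulr_natl.
  apply: ler_sum => u _; rewrite (le_trans (norm_1BX_le _ z1))//.
  apply: (le_trans (ler_wpM2l (ler0n _ _) z8)).
  rewrite mulrA ler_pdivrMr// -[_ * 8]natrM [2^-1 * _]mulrC ler_pdivlMr//.
  rewrite -natrM ler_nat; apply: leq_trans UK.
  have : (u * w <= U.-1 * K.-1)%N by apply: leq_mul; have := ltn_ord u; lia.
  lia.
have : `|U%:R| <= `|D| + `|U%:R - D| by rewrite -{1}[U%:R](subrKC D) ler_normD.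
rewrite normr_nat -lerBlDr; apply: le_trans.
by rewrite lerBrDr (le_trans (lerD (lexx _) UD))// -splitr.
Qed.

(** The kernel is nonnegative, and each solution in the box contributes at least [(U / 2) ^ (2 d)]
    to the sum evaluated by [sum_fejer]. *)
Lemma card_box_congr (C : numClosedFieldType) (m U K d : nat) (z : C)
    (a : 'I_d -> nat) (r : nat) :
  m.-primitive_root z -> `|1 - z| <= 8 / m%:R ->
  (16 * (U.-1 * K.-1) <= m)%N -> (0 < U <= m)%N -> ~~ resonant m U a ->
  (m * #|[set w : {ffun 'I_d -> 'I_m} | [forall j, w j < K] &&
     (\sum_j a j * w j == r %[mod m])]| * U ^ d <= (4 * m) ^ d)%N.
Proof.
move=> zP z8 UK /andP[U0 Um] nres; set W := [set w | _].
have := sum_fejer r zP Um nres; rewrite (bigID (fun w => w \in W)) /= => /eqP.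
have fejer0 (w : {ffun 'I_d -> 'I_m}) : 0 <= \prod_j fejer m U z (w j).
  by rewrite prodr_ge0// => j _; rewrite (fejerE _ _ zP) exprn_ge0.
rewrite mulrDr => /eqP E; have : m%:R * (\sum_(w in W) (U%:R / 2) ^+ 2 ^+ d) <=
    (((U * m) ^ d)%:R : C).
  rewrite -E; apply: ler_wpDr; first by rewrite mulr_ge0 ?sumr_ge0.
  apply: ler_wpM2l => //; rewrite [leRHS](eq_bigl (mem W)); last first.
    by move=> w; rewrite /= !inE andbC -andbA andbb.
  apply: ler_sum => w; rewrite inE => /andP[/forallP wK _].
  rewrite -[d in leLHS]card_ord -prodr_const.
  by apply: ler_prod => j _; rewrite exprn_ge0 ?divr_ge0 ?ler0n//= (fejer_ge zP z8 UK).
have X4 : (U%:R / 2) ^+ 2 ^+ d * 4 ^+ d = (U%:R ^+ d) ^+ 2 :> C.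
  by rewrite -exprMn [in RHS]exprAC; congr (_ ^+ d); field.
rewrite sumr_const => H.
have := ler_wpM2r (exprn_ge0 d (ler0n C 4)) H.
set X := _ ^+ d; set N := #|_|.
have -> : m%:R * (X *+ N) * 4 ^+ d = m%:R * N%:R * (X * 4 ^+ d).
  by rewrite -mulr_natr; ring.
rewrite X4 -!natrX -!natrM ler_nat => {}H.
rewrite -(@leq_pmul2r (U ^ d)) ?expn_gt0 ?U0//.
move: H; rewrite -!expnMn; congr (_ <= _)%N; first lia.
by congr (_ ^ _)%N; lia.
Qed.

Local Open Scope complex_scope.

Lemma sin_le_id (R : realType) (x : R) : 0 <= x -> sin x <= x.
Proof.
rewrite le_eqVlt => /predU1P[<-|x0]; first by rewrite sin0.
have [//|c _] := @MVT R sin cos 0 x x0 (fun y _ => is_derive_sin y).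
  by apply: continuous_subspaceT => y; exact: continuous_sin.
by rewrite sin0 !subr0 => ->; rewrite ler_piMl ?cos_le1// ltW.
Qed.

(** The root is [exp (2 i pi / m)], at distance [2 sin (pi / m) <= 2 pi / m] from 1, and
    [pi < 4]. *)
Lemma exists_prim_root_near1 (R : realType) (m : nat) : (0 < m)%N ->
  exists2 z : R[i], m.-primitive_root z & `|1 - z| <= 8 / m%:R.
Proof.
move=> m0; have mR : 0 < (m%:R : R) by rewrite ltr0n.
pose t : R := pi *+ 2 / m%:R.
have t0 : 0 < t by rewrite divr_gt0// pmulrn_lgt0 ?pi_gt0.
pose z : R[i] := cos t +i* sin t.
have zX k : z ^+ k = cos (t *+ k) +i* sin (t *+ k).
  elim: k => [|k IH]; first by rewrite expr0 !mulr0n cos0 sin0.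
  by rewrite exprS IH mulrS cosD sinD /z; simpc; congr (_ +i* _); ring.
have tm : t *+ m = pi *+ 2 by rewrite -mulr_natr divfK// gt_eqF.
exists z.
  apply/andP; split => //; apply/forallP => -[i im] /=; rewrite unity_rootE zX.
  apply/eqP; have [->|ne] := eqVneq i.+1 m.
    by rewrite tm cos2pi sin2pi eqxx.
  apply/negbTE; rewrite eq_complex /= negb_and; apply/orP; left.
  (* The half angle [pi * i.+1 / m] lies strictly between 0 and [pi], so its sine is nonzero and the
     cosine differs from 1. *)
  have : cos (t *+ i.+1) = 1 - sin (t / 2 *+ i.+1) ^+ 2 *+ 2.
    have -> : t *+ i.+1 = (t / 2 *+ i.+1) *+ 2.
      by rewrite mulrnAC -[X in _ = X *+ _]mulr_natr divfK.
    by rewrite cos_mulr2n cos2sin2; ring.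
  move=> ->; have : 0 < sin (t / 2 *+ i.+1).
    apply: sin_gt0_pi; rewrite pmulrn_lgt0// divr_gt0//=.
    have -> : pi = t / 2 *+ m :> R.
      by rewrite /t -[X in X / _ / _]mulr_natr -mulr_natr; field; rewrite gt_eqF.
    by rewrite ltr_pMn2l ?(divr_gt0 t0)// ltn_neqAle ne.
  by move=> s; rewrite lt_eqF// ltrBlDr ltrDl pmulrn_lgt0// exprn_gt0.
have -> : 8 / m%:R = (8 / m%:R : R)%:C.
  by rewrite rmorphM fmorphV !rmorph_nat.
have tle : t <= 8 / m%:R.
  rewrite ler_pM2r ?invr_gt0//; have := pihalf_lt2 R; lra.
rewrite normc_def /= lecR; apply: le_trans tle.
rewrite -[leRHS]ger0_norm ?(ltW t0)// -sqrtr_sqr ler_sqrt ?sqr_ge0//.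
pose s := t / 2; have s0 : 0 <= s by rewrite divr_ge0 ?(ltW t0).
have ts : t = s *+ 2 by rewrite -mulr_natr divfK.
have -> : (1 - cos t) ^+ 2 + (0 - sin t) ^+ 2 = 4 * sin s ^+ 2.
  rewrite ts sin_mulr2n cos_mulr2n; have := cos2Dsin2 s; nra.
have ss : sin s ^+ 2 <= s ^+ 2; last by rewrite ts; nra.
rewrite lerXn2r ?nnegrE ?sin_le_id//; apply: sin_ge0_pi; rewrite s0 /=.
have -> : s = pi / m%:R by rewrite /s /t; field; rewrite gt_eqF.
by rewrite ler_pdivrMr// ler_peMr ?pi_ge0// ler1n.
Qed.

(** * Covering all residues by boxes *)

(* Think of [B t] as the [t]-fold sumset of a symmetric set. As long as it keeps
   growing, pick [f i] in [B (3 i + 3)] but not in [B (3 i + 2)]: the translates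
   [f i + B 1] are pairwise disjoint, so that there are few of them. *)
Lemma sumset_full (V : finZmodType) (B : nat -> {set V}) (q : nat) :
  (forall t, 0 \in B t) ->
  (forall s t x y, x \in B s -> y \in B t -> x - y \in B (s + t)%N) ->
  (forall t, B t.+1 \subset B t -> B t = [set: V]) ->
  (#|V| < q * #|B 1%N|)%N -> B (3 * q)%N = [set: V].
Proof.
move=> B0 BB Bstab qB; apply/eqP/negPn/negP => nB.
have BD s t x y : x \in B s -> y \in B t -> x + y \in B (s + t)%N.
  move=> xs yt; have -> : x + y = x - (0 - y) by rewrite sub0r opprK.
  by apply: (BB) => //; rewrite -[t]add0n BB.
have Bmono s t : (s <= t)%N -> B s \subset B t.
  move=> st; apply/subsetP => x xs; rewrite -(subnKC st) -[x]addr0.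
  exact: BD.
have ex t : (t < 3 * q)%N -> exists x, (x \in B t.+1) && (x \notin B t).
  move=> tq; case: (pickP (fun x => (x \in B t.+1) && (x \notin B t))) => [x xP|].
    by exists x.
  move=> H; case/negP: nB; rewrite -subTset.
  have tT : B t = [set: V].
    apply: Bstab; apply/subsetP => x xt.
    by have := H x; rewrite xt /= => /negbFE.
  by rewrite -tT Bmono// ltnW.
have lti (i : 'I_q) : (3 * i + 2 < 3 * q)%N by have := ltn_ord i; lia.
pose f (i : 'I_q) := xchoose (ex _ (lti i)).
have fP i : (f i \in B (3 * i + 3)%N) && (f i \notin B (3 * i + 2)%N).
  by rewrite [(3 * i + 3)%N]addnS; exact: xchooseP (ex _ (lti i)).
(* Equality would put [f j = f i + x - y] in [B (3 i + 5)], hence in [B (3 j + 2)], against the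
   choice of [f j]. *)
have neq (i j : 'I_q) x y : x \in B 1%N -> y \in B 1%N -> (i < j)%N ->
    f i + x <> f j + y.
  move=> xB yB ij E; have /andP[_ /negP] := fP j; apply.
  have -> : f j = (f i + x) - y by rewrite E addrK.
  have /andP[fi _] := fP i.
  apply: (subsetP (@Bmono (3 * i + 3 + 1 + 1)%N _ _)); first lia.
  by apply: BB => //; apply: BD.
have : (#|setX [set: 'I_q] (B 1%N)| <= #|V|)%N.
  rewrite -(@card_in_imset _ _ (fun p : 'I_q * V => f p.1 + p.2)) ?max_card//.
  move=> [i x] [j y]; rewrite !inE /= => xB yB E.
  have [ij|ji|/val_inj ij] := ltngtP i j.
  - by case: (neq i j x y).
  - by case: (neq j i y x).
  - by congr (_, _) => //; move: E; rewrite ij => /addrI.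
by rewrite cardsX cardsT card_ord leqNgt qB.
Qed.

Lemma card_bigcup_leq (I T : finType) (P : pred I) (F : I -> {set T}) :
  (#|\bigcup_(i | P i) F i| <= \sum_(i | P i) #|F i|)%N.
Proof.
elim/big_rec2: _ => [|i m A _ Am]; first by rewrite cards0.
by rewrite (leq_trans (leq_card_setU _ _))// leq_add2l.
Qed.

(** The [K ^ d] points of the box fall into the classes reached, each holding at most
    [(4 m) ^ d / (m U ^ d)] of them by [card_box_congr]. With [m <= 16 U K], this leaves at least
    [m / 64 ^ d] classes. *)
Lemma card_residues (C : numClosedFieldType) (m U K d : nat) (z : C)
    (a : 'I_d -> nat) :
  m.-primitive_root z -> `|1 - z| <= 8 / m%:R ->
  (16 * (U.-1 * K.-1) <= m)%N -> (m <= 16 * (U * K))%N -> (0 < U <= m)%N ->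
  (K <= m)%N -> ~~ resonant m U a ->
  (m <= 64 ^ d * #|[set r : 'I_m | [exists w : {ffun 'I_d -> 'I_m},
     [forall j, w j < K] && (\sum_j a j * w j == r %[mod m])]]|)%N.
Proof.
move=> zP z8 UK mUK Um Km nres; set S := [set r | _].
have m0 := prim_order_gt0 zP.
pose W (r : 'I_m) := [set w : {ffun 'I_d -> 'I_m} | [forall j, w j < K] &&
     (\sum_j a j * w j == r %[mod m])]%N.
have cW r : (m * #|W r| * U ^ d <= (4 * m) ^ d)%N.
  exact: (card_box_congr r zP z8 UK Um nres).
have KW : (K ^ d <= \sum_(r in S) #|W r|)%N.
  pose D := [set w : {ffun 'I_d -> 'I_m} | [forall j, w j < K]%N].
  have -> : (K ^ d = #|D|)%N.
    have -> : #|D| = (#|[pred x : 'I_m | x < K]%N| ^ #|'I_d|)%N.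
      rewrite -card_ffun_on; apply: eq_card => w; rewrite !inE.
      by apply/forallP/ffun_onP.
    rewrite card_ord; congr (_ ^ _)%N.
    have inj : injective (widen_ord Km) by move=> x y [xy]; exact: val_inj.
    rewrite -[LHS]card_ord -(card_imset _ inj).
    apply: eq_card => x; rewrite !inE; apply/imsetP/idP => [[y _ ->] /=|xK].
      exact: ltn_ord.
    by exists (Ordinal xK) => //; apply: val_inj.
  have -> : D = \bigcup_(r in S) W r.
    apply/setP => w; rewrite inE; apply/idP/bigcupP => [wD|[r _]]; last first.
      by rewrite inE => /andP[].
    exists (Ordinal (ltn_pmod (\sum_j a j * w j)%N m0)).
      by rewrite inE; apply/existsP; exists w; rewrite wD /= modn_mod.
    by rewrite inE wD /= modn_mod.
  exact: card_bigcup_leq.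
have H : (K ^ d * m * U ^ d <= #|S| * (4 * m) ^ d)%N.
  rewrite (leq_trans (_ : _ <= (\sum_(r in S) #|W r|) * m * U ^ d)%N)//.
    by rewrite -!mulnA leq_mul2r KW orbT.
  rewrite -sum_nat_const big_distrl big_distrl /=; apply: leq_sum => r _.
  by rewrite [(_ * m)%N]mulnC.
rewrite -(@leq_pmul2r (m ^ d)) ?expn_gt0 ?m0//.
have H2 : (m ^ d <= 16 ^ d * U ^ d * K ^ d)%N.
  by rewrite -!expnMn -mulnA; case: (d) => // k; rewrite leq_exp2r.
apply: (leq_trans (leq_mul (leqnn m) H2)).
rewrite (_ : m * _ = 16 ^ d * (K ^ d * m * U ^ d))%N; last by lia.
apply: (leq_trans (leq_mul (leqnn _) H)).
by rewrite (_ : 64 = 16 * 4)%N// !expnMn; lia.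
Qed.

Lemma Zp1_mulrn (m n : nat) : (inZp 1 : 'I_m.+1) *+ n = inZp n.
Proof.
elim: n => [|n IH]; first by apply: val_inj; rewrite /= mod0n.
by apply: val_inj; rewrite mulrS IH /= modnDm.
Qed.

Lemma Zp1_mulrz_eq0 (m : nat) (k : int) :
  ((inZp 1 : 'I_m.+1) *~ k == 0) = (m.+1 %| k)%Z.
Proof.
have nat_case (n : nat) : ((inZp 1 : 'I_m.+1) *+ n == 0) = (m.+1 %| n)%N.
  by rewrite Zp1_mulrn -val_eqE /=.
case: k => n; first by rewrite -pmulrn nat_case.
by rewrite NegzE -nmulrn oppr_eq0 nat_case dvdzE abszN.
Qed.

(** [sumset_full] applies to the residues of combinations with integer coefficients of absolute
    value at most [t * K]; a translation then makes the coefficients nonnegative. *)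
Lemma box_covers (m K q d : nat) (a : 'I_d -> nat) :
  (0 < m)%N -> (0 < K)%N ->
  (exists c : 'I_d -> int, (m %| \sum_j (a j)%:Z * c j - 1)%Z) ->
  (m < q * #|[set r : 'I_m | [exists w : {ffun 'I_d -> 'I_m},
     [forall j, w j < K] && (\sum_j a j * w j == r %[mod m])]]|)%N ->
  forall b : nat, exists2 y : 'I_d -> nat, (forall j, y j <= 6 * q * K)%N &
    (\sum_j a j * y j = b %[mod m])%N.
Proof.
case: m => // m _ K0 [c cP] qS b.
pose e : 'I_m.+1 := inZp 1.
pose L (w : 'I_d -> int) : int := \sum_j (a j)%:Z * w j.
have eqe (x y : int) : (e *~ x == e *~ y) = (m.+1 %| x - y)%Z.
  by rewrite -subr_eq0 -mulrzBr Zp1_mulrz_eq0.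
have LD w w' : L (fun j => w j + w' j) = L w + L w'.
  by rewrite /L -big_split; apply: eq_bigr => j _; rewrite mulrDr.
have LN w : L (fun j => - w j) = - L w.
  by rewrite /L -sumrN; apply: eq_bigr => j _; rewrite mulrN.
pose B (t : nat) := [set r : 'I_m.+1 | `[< exists2 w : 'I_d -> int,
  (forall j, `|w j| <= (t * K)%N%:Z) & r = e *~ L w >]].
have BP t r : reflect (exists2 w : 'I_d -> int,
    (forall j, `|w j| <= (t * K)%N%:Z) & r = e *~ L w) (r \in B t).
  by rewrite inE; exact: asboolP.
have B0 t : 0 \in B t.
  apply/BP; exists (fun=> 0) => [j|]; first by rewrite normr0.
  by rewrite /L big1 ?mulr0z// => j _; rewrite mulr0.
have BB s t x y : x \in B s -> y \in B t -> x - y \in B (s + t)%N.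
  move=> /BP[w wK ->] /BP[w' wK' ->]; apply/BP.
  exists (fun j => w j + - w' j); last by rewrite LD LN mulrzBr.
  by move=> j; have := wK j; have := wK' j; rewrite mulnDl; lia.
(* Since [K >= 1], the next box has room for one more [a j] or its opposite. A stationary [B t] is
   thus closed under adding multiples of the [a j], and the Bezout coefficients [c] reach every
   residue. *)
have Bstab t : B t.+1 \subset B t -> B t = [set: 'I_m.+1].
  move=> /subsetP sub.
  have step (j : 'I_d) (s : int) x : `|s| = 1 -> x \in B t ->
      x + e *~ ((a j)%:Z * s) \in B t.
    move=> s1 /BP[w wK ->]; apply: sub; apply/BP.
    exists (fun i => w i + (if i == j then s else 0)).
      move=> i; rewrite (le_trans (ler_normD _ _))// mulSn addnC PoszD lerD//.
      by case: ifP => _; [rewrite s1; lia|rewrite normr0].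
    rewrite LD mulrzDr; congr (_ + _ *~ _).
    rewrite /L (bigD1 j) //= eqxx [X in _ + X]big1 ?addr0// => i ij.
    by rewrite (negPf ij) mulr0.
  have stepz (j : 'I_d) (s : int) x : x \in B t ->
      x + e *~ ((a j)%:Z * s) \in B t.
    elim: s x => [|n IH|n IH] x xB; first by rewrite mulr0 mulr0z addr0.
      by rewrite -addn1 PoszD mulrDr mulrzDr addrA step// IH.
    by rewrite -addn1 PoszD opprD mulrDr mulrzDr addrA step// IH.
  have steps w x : x \in B t -> x + e *~ L w \in B t.
    rewrite /L; elim/big_ind: _ x => [x|u v IHu IHv x xB|j _ x]; last exact: stepz.
      by rewrite mulr0z addr0.
    by rewrite mulrzDr addrA; apply: IHv; apply: IHu.
  apply/setP => r; rewrite in_setT.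
  have -> : r = 0 + e *~ L (fun j => c j * (r : nat)%:Z).
    have -> : L (fun j => c j * (r : nat)%:Z) = L c * (r : nat)%:Z.
      by rewrite /L mulr_suml; apply: eq_bigr => j _; rewrite mulrA.
    have Lc : e = e *~ L c.
      by rewrite -[e in LHS]mulr1z; apply/eqP; rewrite eq_sym eqe.
    by rewrite add0r mulrzA -Lc -pmulrn Zp1_mulrn valZpK.
  exact: steps (B0 t).
have BT : B (3 * q)%N = [set: 'I_m.+1].
  apply: sumset_full => //; rewrite card_ord (leq_trans qS)//.
  rewrite leq_mul2l; apply/orP; right; apply: subset_leq_card.
  apply/subsetP => r; rewrite inE => /existsP[w /andP[/forallP wK wr]].
  apply/BP; exists (fun j => (w j)%:Z).
    by move=> j /=; rewrite mul1n ger0_norm// lez_nat ltnW//; exact: wK.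
  have -> : L (fun j => (w j : nat)%:Z) = (\sum_j a j * w j)%N%:Z.
    by rewrite /L (big_morph Posz PoszD (erefl _)).
  rewrite -pmulrn Zp1_mulrn; apply: val_inj => /=.
  by rewrite (eqP wr) modn_small.
(* Shifting all coefficients by [T] moves them from [[-T, T]] to [[0, 6 q K]]; the target residue is
   corrected by the shift. *)
pose T := (3 * q * K)%N.
have : e *~ (b%:Z - L (fun=> T%:Z)) \in B (3 * q)%N by rewrite BT in_setT.
move=> /BP[w wT /eqP]; rewrite eqe => H.
have w0 j : 0 <= w j + T%:Z by have := wT j; lia.
exists (fun j => absz (w j + T%:Z)).
  by move=> j; have := wT j; have := w0 j; lia.
apply/eqP; rewrite eq_sym -eqz_nat -!modz_nat eqz_mod_dvd.
rewrite (big_morph Posz PoszD (erefl _)) (_ : \sum_j _ = L w + L (fun=> T%:Z)).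
  by rewrite [L w + _]addrC opprD addrA.
by rewrite -LD; apply: eq_bigr => j _; rewrite PoszM gez0_abs.
Qed.

(** * Counting resonant vectors *)

Lemma coprime_Bezout (m d : nat) (a : 'I_d -> nat) :
  coprime m (\big[gcdn/0%N]_j a j) ->
  exists c : 'I_d -> int, (m %| \sum_j (a j)%:Z * c j - 1)%Z.
Proof.
move=> co; have [c cE] : exists c : 'I_d -> int,
    \sum_j (a j)%:Z * c j = (\big[gcdn/0%N]_j a j)%:Z.
  elim/big_ind: (\big[_/_]_j _) => [|x y [c cE] [c' cE']|j _].
  - by exists (fun=> 0); rewrite big1// => j _; rewrite mulr0.
  - have [u [v E]] := Bezoutz x y.
    exists (fun j => u * c j + v * c' j).
    have -> : (gcdn x y)%:Z = u * x + v * y by rewrite E.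
    rewrite -cE -cE' !mulr_sumr -big_split; apply: eq_bigr => j _ /=; ring.
  - exists (fun i => (i == j)%:R); rewrite (bigD1 j)//= eqxx mulr1 big1 ?addr0//.
    by move=> i ij; rewrite (negPf ij) mulr0.
have [u [v E]] := Bezoutz m (\big[gcdn/0%N]_j a j)%:Z.
exists (fun j => c j * v); apply/dvdzP; exists (- u).
have -> : 1 = u * m + v * (\big[gcdn/0%N]_j a j)%:Z.
  by rewrite E; move: co; rewrite /coprime /gcdz /= => /eqP ->.
rewrite -cE.
have -> : \sum_j (a j)%:Z * (c j * v) = (\sum_j (a j)%:Z * c j) * v.
  by rewrite mulr_suml; apply: eq_bigr => j _; rewrite mulrA.
ring.
Qed.

Local Open Scope nat_scope.

(** Divide by [g = gcdn h m]: modulo [q = m / g], the multiple [(h / g) x] is within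
    [B = (U - 1) / g] of 0, and [h / g] is invertible. So each block of [q] consecutive [x] has at
    most [2 (B + 1)] solutions. *)
Lemma card_near0_multiples (m M U h : nat) : 0 < m <= M -> U <= m ->
  gcdn h m < U ->
  m * #|[set x : 'I_M.+1 | [exists u : 'I_U, [exists v : 'I_U,
    h * x + u == v %[mod m]]]]| <= 8 * U * M.
Proof.
move=> /andP[m0 mM] Um gU; set X := [set x | _]; set g := gcdn h m in gU.
have g0 : 0 < g by rewrite gcdn_gt0 m0 orbT.
pose q := m %/ g; pose h' := h %/ g.
have mE : m = g * q by rewrite mulnC divnK// dvdn_gcdr.
have hE : h = g * h' by rewrite mulnC divnK// dvdn_gcdl.
have q0 : 0 < q by rewrite divn_gt0// dvdn_leq// dvdn_gcdr.
have co : coprime q h'.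
  rewrite /coprime -(eqn_pmul2l g0) muln1 muln_gcdr -mE -hE gcdnC; exact: eqxx.
pose w (x : 'I_M.+1) := (h' * x) %% q.
pose B := U.-1 %/ g.
have wP x : x \in X -> (w x <= B) || (q - w x <= B).
  rewrite inE => /existsP[u /existsP[v]].
  have wq : w x < q by rewrite ltn_mod.
  have gw : g * w x = (h * x) %% m by rewrite /w muln_modr -mE mulnA -hE.
  rewrite -modnDml -gw /B !leq_divRL// mulnBl [q * g]mulnC -mE [w x * g]mulnC.
  have gwm : g * w x < m by rewrite gw ltn_mod.
  have := ltn_ord u; have := ltn_ord v => vU uU.
  rewrite [v %% m]modn_small ?(leq_trans vU)//.
  have [lt|ge] := ltnP (g * w x + u) m; first by rewrite modn_small// => /eqP; lia.
  rewrite -{1}(subnK ge) modnDr modn_small; last by lia.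
  by move=> /eqP; lia.
(* An injective code on [X]: the block of [x], the side of 0 on which [w x] lies, and its distance
   to 0 modulo [q]. *)
pose f (x : 'I_M.+1) : 'I_(M %/ q).+1 * (bool * 'I_B.+1) :=
  (inord (x %/ q), (w x <= B, inord (if w x <= B then w x else q - w x))).
have finj : {in X &, injective f}.
  move=> x y xX yX E; have := congr1 (fun p => val p.1) E.
  have sB : (w x <= B) = (w y <= B) := congr1 (fun p => p.2.1) E.
  have := congr1 (fun p => val p.2.2) E.
  rewrite /f /= -sB => {E}; rewrite !inordK ?ltnS; last 4 first.
  - exact/leq_div2r/leq_ord.
  - exact/leq_div2r/leq_ord.
  - by have := wP _ yX; case: ifP; rewrite sB => ->.
  - by have := wP _ xX; case: ifP => // ->.
  move=> wE xyq; have {}wE : w x = w y.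
    have wx : w x < q := ltn_pmod _ q0; have wy : w y < q := ltn_pmod _ q0.
    by move: wE; case: ifP => _; lia.
  apply: val_inj => /=; rewrite (divn_eq x q) (divn_eq y q) xyq; congr (_ + _).
  wlog yx : x y xX yX xyq sB wE / (y <= x).
    by move=> H; have [/H|/ltnW/H] := leqP y x; [apply|move=> E; symmetry; apply: E].
  apply/eqP; rewrite eqn_mod_dvd// -(Gauss_dvdr _ co) mulnBr -eqn_mod_dvd ?leq_mul2l ?yx ?orbT//.
  exact/eqP.
have cX : #|X| <= (M %/ q).+1 * (2 * B.+1).
  rewrite -(card_in_imset finj) (leq_trans (max_card _))//.
  by rewrite !card_prod !card_ord card_bool.
apply: leq_trans (leq_mul (leqnn m) cX) _.
rewrite {1}mE (_ : _ * _ = 2 * (q * (M %/ q).+1) * (g * B.+1)); last by lia.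
(* Rounding up costs a factor 2 here because [q <= m <= M], and again in [H2] because [g < U]. *)
have H1 : q * (M %/ q).+1 <= 2 * M.
  rewrite mulnS mulnC; have := leq_trunc_div M q.
  have : q <= m by rewrite leq_div.
  lia.
have H2 : g * B.+1 <= 2 * U.
  by rewrite mulnS mulnC; have := leq_trunc_div U.-1 g; rewrite -/B; lia.
by have := leq_mul H1 H2; lia.
Qed.

(** A union bound over [h], with [card_near0_multiples] for each coordinate; coprimality excludes
    the [h] with [gcdn h m >= U]. *)
Lemma card_resonant (m M U d : nat) : 0 < m <= M -> U <= m ->
  m ^ d * #|[set a : {ffun 'I_d -> 'I_M.+1} | resonant m U (fun j => a j) &&
    coprime m (\big[gcdn/0]_j a j)]| <= m * (8 * U * M) ^ d.
Proof.
move=> mM Um; have /andP[m0 _] := mM; set S := [set a | _].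
pose X h := [set x : 'I_M.+1 | [exists u : 'I_U, [exists v : 'I_U,
    h * x + u == v %[mod m]]]].
have : S \subset \bigcup_(h : 'I_m | (0 < h) && (gcdn h m < U))
    [set a : {ffun 'I_d -> 'I_M.+1} | a \in ffun_on (mem (X h))].
  apply/subsetP => a; rewrite inE => /andP[/existsP[h /andP[h0 /forallP ha]] co].
  apply/bigcupP; exists h; last first.
    by rewrite inE; apply/ffun_onP => j; rewrite inE ha.
  (* If [U <= g], then [u] and [v], congruent modulo [g], are equal. So [m] divides every [h * a j],
     and [m / g > 1] divides every [a j]. *)
  rewrite h0 ltnNge; apply/negP => Ug; set g := gcdn h m in Ug.
  have g0 : 0 < g by rewrite gcdn_gt0 m0 orbT.
  have gm : g < m by rewrite (leq_ltn_trans _ (ltn_ord h))// dvdn_leq// dvdn_gcdl.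
  have qdvd : m %/ g %| gcdn m (\big[gcdn/0]_j a j).
    rewrite dvdn_gcd dvdn_div ?dvdn_gcdr//=; apply/dvdn_biggcdP => j _.
    have /existsP[u /existsP[v huv]] := ha j.
    have uv : (u : nat) = v.
      have : g %| h * a j by rewrite dvdn_mulr// dvdn_gcdl.
      move=> /eqP gh; have : u == v %[mod g].
        have /eqP/(congr1 (modn^~ g)) := huv.
        by rewrite !modn_dvdm ?dvdn_gcdr// -modnDml gh add0n => /eqP.
      by rewrite !modn_small ?(leq_trans (ltn_ord _))// => /eqP.
    have mha : m %| h * a j.
      by move: huv; rewrite uv -[X in _ == X %[mod _]]add0n eqn_modDr mod0n.
    pose q := m %/ g; pose h' := h %/ g.
    have mE : m = g * q by rewrite mulnC divnK// dvdn_gcdr.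
    have hE : (h : nat) = g * h' by rewrite mulnC divnK// dvdn_gcdl.
    have co' : coprime q h'.
      rewrite /coprime -(eqn_pmul2l g0) muln1 muln_gcdr -mE -hE gcdnC; exact: eqxx.
    have : g * q %| g * h' * a j by rewrite -mE -hE.
    by rewrite -mulnA dvdn_pmul2l// Gauss_dvdr.
  move: qdvd; rewrite (eqP co) dvdn1 => /eqP q1.
  by have := divnK (dvdn_gcdr h m : g %| m); rewrite q1 mul1n => E; rewrite E ltnn in gm.
move=> /subset_leq_card/leq_trans/(_ (card_bigcup_leq _ _)) H.
apply: leq_trans (leq_mul (leqnn _) H) _.
rewrite big_distrr /= -[m in m * _]card_ord -sum_nat_const big_mkcond /=.
rewrite [leqRHS](eq_bigl xpredT)//.
apply: leq_sum => h _; case: ifP => // /andP[_ hU].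
rewrite cardsE card_ffun_on card_ord -expnMn.
have := card_near0_multiples mM Um hU; rewrite -/(X h).
by case: (d) => // k; rewrite leq_exp2r.
Qed.

Local Open Scope ring_scope.

(** * Counting primitive vectors *)

Definition primitive_vectors (n M : nat) : {set {ffun 'I_n -> 'I_M.+1}} :=
  [set f : {ffun 'I_n -> 'I_M.+1} |
    [forall j, 0 < f j] && (\big[gcdn/0]_j (f j : nat) == 1)]%N.

(** Telescoping with [1 / (x + 1) ^ 2 <= 1 / x - 1 / (x + 1)], starting from
    [1 / 4 = 3 / 4 - 1 / 2]. *)
Lemma sum_inv_sqr_le (F : realFieldType) (M : nat) :
  \sum_(2 <= g < M.+1) ((g%:R : F) ^+ 2)^-1 <= 3 / 4.
Proof.
case: M => [|[|M]]; [by rewrite big_geq// divr_ge0 ?ler0n..|].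
suff H : \sum_(2 <= g < M.+3) ((g%:R : F) ^+ 2)^-1 <= 3 / 4 - M.+2%:R^-1.
  by rewrite (le_trans H)// lerBlDr lerDl invr_ge0 ler0n.
elim: M => [|M IH]; first by rewrite big_nat1; lra.
rewrite big_nat_recr//= (le_trans (lerD IH (lexx _)))//.
set x : F := M.+2%:R.
have x0 : 0 < x by rewrite ltr0n.
have -> : M.+3%:R = x + 1 :> F by rewrite /x natr1.
clearbody x.
rewrite -subr_ge0.
have -> : 3 / 4 - (x + 1)^-1 - (3 / 4 - x^-1 + (x + 1) ^- 2) = (x * (x + 1) ^+ 2)^-1.
  by field; rewrite !gt_eqF ?addr_gt0.
by rewrite invr_ge0 mulr_ge0 ?exprn_ge0 ?addr_ge0 ?ltW.
Qed.

Lemma card_multiples (M g : nat) : (0 < g)%N ->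
  (#|[set x : 'I_M.+1 | (0 < x) && (g %| x)]| <= M %/ g)%N.
Proof.
move=> g0; pose F (k : 'I_(M %/ g)) : 'I_M.+1 := inord (k.+1 * g).
apply: (@leq_trans #|F @: [set: _]|); last first.
  by rewrite (leq_trans (leq_imset_card _ _))// cardsT card_ord.
apply: subset_leq_card; apply/subsetP => x; rewrite inE => /andP[x0 /dvdnP[k xE]].
have k0 : (0 < k)%N by move: x0; rewrite xE muln_gt0 => /andP[].
have kM : (k.-1 < M %/ g)%N by rewrite prednK// leq_divRL// -xE -ltnS.
apply/imsetP; exists (Ordinal kM) => //=; apply: val_inj => /=.
by rewrite /F /= prednK// -xE inordK.
Qed.

(** At most [(M / g) ^ n <= M ^ n / g ^ 2] vectors have all entries divisible by [g]; summing over
    [g >= 2] discards at most three quarters of the [M ^ n] vectors. *)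
Lemma card_primitive_vectors (n M : nat) :
  (1 < n)%N -> (M ^ n <= 4 * #|primitive_vectors n M|)%N.
Proof.
move=> n1; set E := primitive_vectors n M.
pose X g := [set x : 'I_M.+1 | (0 < x) && (g %| x)]%N.
pose D g := [set f : {ffun 'I_n -> 'I_M.+1} | f \in ffun_on (mem (X g))].
have cD g : #|D g| = (#|X g| ^ n)%N by rewrite cardsE card_ffun_on card_ord.
have X1 : #|X 1%N| = M.
  have c0 := cardsC1 (ord0 : 'I_M.+1); rewrite card_ord /= in c0; rewrite -[RHS]c0.
  by apply: eq_card => x; rewrite !inE dvd1n andbT lt0n.
have sub : D 1%N \subset E :|: \bigcup_(g : 'I_M.+1 | (2 <= g)%N) D g.
  apply/subsetP => f; rewrite inE => /ffun_onP fX.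
  have f0 j : (0 < f j)%N by have := fX j; rewrite inE => /andP[].
  rewrite inE [f \in E]inE; have -> /= : [forall j, 0 < f j]%N by apply/forallP.
  case: eqP => //= g1; set g := \big[gcdn/0%N]_j (f j : nat) in g1.
  have gdvd j : (g %| f j)%N by rewrite /g (bigD1 j)//= dvdn_gcdl.
  pose i0 : 'I_n := Ordinal (ltnW n1).
  have gf : (g <= f i0)%N by rewrite dvdn_leq.
  have g0 : (0 < g)%N by rewrite (dvdn_gt0 _ (gdvd i0)).
  apply/bigcupP; exists (inord g); rewrite ?inordK ?(leq_ltn_trans gf)//; first lia.
  by rewrite inE; apply/ffun_onP => j; rewrite inE f0 gdvd.
have {}sub := leq_trans (subset_leq_card sub) (leq_card_setU _ _).
have {}sub := leq_trans sub (leq_add (leqnn _) (card_bigcup_leq _ _)).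
move: sub; rewrite cD X1 -(ler_nat rat) natrD natrX natr_sum => H.
rewrite -(ler_nat rat) natrM natrX.
have : \sum_(g < M.+1 | (2 <= g)%N) #|D g|%:R <= M%:R ^+ n * (3 / 4) :> rat.
  apply: (@le_trans _ _ (\sum_(g < M.+1 | (2 <= g)%N) M%:R ^+ n * (g%:R ^+ 2)^-1)); last first.
    rewrite -mulr_sumr ler_wpM2l ?exprn_ge0//.
    rewrite -(big_mkord (fun g => 2 <= g)%N (fun g => (g%:R ^+ 2)^-1 : rat)).
    apply: le_trans (sum_inv_sqr_le _ M).
    by rewrite [leRHS](big_nat_widenl _ 0%N).
  apply: ler_sum => g g2; rewrite cD natrX.
  have g0 : (0 < g)%N by rewrite ltnW.
  have gR : 0 < g%:R :> rat by rewrite ltr0n.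
  have XM : #|X g|%:R <= M%:R / g%:R :> rat.
    rewrite ler_pdivlMr// -natrM ler_nat.
    by rewrite (leq_trans _ (leq_trunc_div M g))// leq_mul2r card_multiples ?orbT.
  rewrite (le_trans (lerXn2r _ _ _ XM)) ?nnegrE ?divr_ge0//.
  rewrite expr_div_n ler_wpM2l ?exprn_ge0// lef_pV2 ?posrE ?exprn_gt0//.
  by rewrite ler_weXn2l// ler1n.
lra.
Qed.

(** * From coverings to integrality gaps *)

Lemma IP_pointsE (n : nat) (A : 'rV[int]_n) (b : int) (x : 'cV[int]_n) :
  IP_points A b x <-> \sum_j A 0 j * x j 0 = b /\ forall j, 0 <= x j 0.
Proof.
split=> -[xb x0]; split=> //.
  by move/matrixP: xb => /(_ 0 0); rewrite !mxE eqxx mulr1n.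
by apply/matrixP => i j; rewrite !ord1 !mxE eqxx mulr1n.
Qed.

Lemma LP_pointsE (R : realType) (n : nat) (A : 'rV[int]_n) (b : int)
    (x : 'cV[R]_n) :
  LP_points A b x <->
  \sum_j (A 0 j)%:~R * x j 0 = b%:~R /\ forall j, 0 <= x j 0.
Proof.
split=> -[xb x0]; split=> //.
  move/matrixP: xb => /(_ 0 0); rewrite !mxE eqxx mulr1n => <-.
  by apply: eq_bigr => j _; rewrite mxE.
apply/matrixP => i j; rewrite !ord1 !mxE eqxx mulr1n -xb.
by apply: eq_bigr => k _; rewrite mxE.
Qed.

Lemma le_norm_inf (n : nat) (A : 'rV[int]_n) (i : 'I_n) : A 0 i <= norm_inf A.
Proof.
by rewrite (le_trans (ler_norm _))// (le_bigmax _ (fun j => `|A 0 j|)).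
Qed.

Lemma cost_le (R : realType) (n m : nat) (c : 'rV[rat]_n) (A : 'rV[int]_n)
    (b : int) (x : 'cV[int]_n) :
  (0 < m)%N -> (forall i, m%:Z <= A 0 i) -> IP_points A b x ->
  cost c (map_mx intr x : 'cV[R]_n) <= ratr (norm1 c) * (b%:~R / m%:R).
Proof.
move=> m0 mA /IP_pointsE[xb x0].
rewrite /cost /norm1 rmorph_sum mulr_suml; apply: ler_sum => j _ /=.
have xj : (x j 0)%:~R <= b%:~R / m%:R :> R.
  rewrite ler_pdivlMr ?ltr0n// -[m%:R]/(m%:~R) -intrM ler_int -xb.
  rewrite (bigD1 j)//= ler_wpDr ?sumr_ge0// => [i _|].
    by rewrite mulr_ge0// (le_trans _ (mA i)).
  by rewrite mulrC ler_wpM2r.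
rewrite mxE ratr_norm (le_trans (ler_wpM2r _ (ler_norm _))) ?ler0z//.
by rewrite ler_wpM2l.
Qed.

(** Weak duality: the smallest ratio [c l / A l] is a feasible dual solution. *)
Lemma LP_ge (R : realType) (n : nat) (c : 'rV[rat]_n) (A : 'rV[int]_n)
    (b : int) (l : 'I_n) :
  (forall i, 0 < A 0 i) ->
  (forall i, c 0 l / (A 0 l)%:~R <= c 0 i / (A 0 i)%:~R) ->
  ((ratr (c 0 l) / (A 0 l)%:~R * b%:~R : R)%:E <= LP R c A b)%E.
Proof.
move=> A0 lmin; apply: le_ereal_inf_tmp => _ [x /LP_pointsE[xb x0] <-].
rewrite lee_fin -xb mulr_sumr; apply: ler_sum => i _; rewrite mulrA ler_wpM2r//.
rewrite -ler_pdivlMr ?ltr0z//.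
have := lmin i; rewrite -(ler_rat R).
by rewrite !rmorphM/= !fmorphV/= !ratr_int.
Qed.

(* The linear relaxation has an optimal vertex on the axis [l] minimizing
   [c l / A l]; an integer point for [b] is obtained from one for a
   representable [b' <= F + |A|] with [b' = b mod A l] by moving along this
   axis. *)
Lemma IG_le (R : realType) (n m F : nat) (c : 'rV[rat]_n) (A : 'rV[int]_n)
    (b : int) :
  (0 < n)%N -> (0 < m)%N -> (forall i, m%:Z <= A 0 i) ->
  (forall b' : nat, (F <= b')%N -> IP_feasible A b') ->
  IP_feasible A b ->
  (IG R c A b <= (ratr (norm1 c) * (2 * (F%:R + (norm_inf A)%:~R) / m%:R))%:E)%E.
Proof.
move=> n0 m0 mA hF fb.
have A0 i : 0 < A 0 i by rewrite (lt_le_trans _ (mA i)).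
pose i0 := Ordinal n0.
have [l lmin] : exists l, forall i, c 0 l / (A 0 l)%:~R <= c 0 i / (A 0 i)%:~R.
  case: (@Order.TotalTheory.arg_minP _ _ _ i0 xpredT
    (fun i => c 0 i / (A 0 i)%:~R)) => // l _ H.
  by exists l => i; exact: H.
have [b' [k [x [k0 xP b'F bE]]]] : exists b' k x, [/\ 0 <= k, IP_points A b' x,
    b' <= F%:Z + norm_inf A & b = b' + k * A 0 l].
  (* A small [b] is its own [b']. Otherwise [b - F = k * A l + r] and [b' = F + r]. *)
  have [bF|bF] := leP b (F%:Z + norm_inf A).
    by have [x xP] := fb; exists b, 0, x; split; rewrite ?mul0r ?addr0.
  have bF0 : 0 <= b - F%:Z by have := le_norm_inf A l; have := A0 l; lia.
  have := divz_eq (b - F%:Z) (A 0 l); set k := divz _ _; set r := modz _ _ => kE.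
  have r0 : 0 <= r by rewrite modz_ge0// gt_eqF.
  have rA : r < A 0 l by rewrite ltz_pmod.
  have [x xP] := hF (absz (F%:Z + r)) ltac:(lia).
  exists (F%:Z + r), k, x; split.
  - by rewrite /k divz_ge0// A0.
  - by move: xP; rewrite gez0_abs//; lia.
  - by have := le_norm_inf A l; lia.
  - by lia.
have b'0 : 0 <= b'.
  have /IP_pointsE[<- x0] := xP; rewrite sumr_ge0// => i _.
  by rewrite mulr_ge0// ltW.
have IPle : (IP R c A b <=
    (cost c (map_mx intr x : 'cV[R]_n) + ratr (c 0 l) * k%:~R)%:E)%E.
  apply: ereal_inf_lbound; exists (x + k *: delta_mx l 0).
    have /IP_pointsE[xb x0] := xP; apply/IP_pointsE; split; last first.
      by move=> j; rewrite !mxE addr_ge0// mulr_ge0.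
    rewrite bE -xb.
    under eq_bigr do rewrite !mxE mulrDr eqxx andbT.
    rewrite big_split; congr (_ + _) => /=.
    rewrite (bigD1 l)//= eqxx mulr1 big1 ?addr0 1?mulrC// => j jl.
    by rewrite (negPf jl) !mulr0.
  congr (_%:E); rewrite /cost.
  under eq_bigr do rewrite !mxE rmorphD rmorphM/= mulrDr eqxx andbT.
  rewrite big_split /=; congr (_ + _).
    by apply: eq_bigr => j _; rewrite mxE.
  rewrite (bigD1 l)//= eqxx mulr1 big1 ?addr0// => j jl.
  by rewrite (negPf jl) !mulr0.
apply: (le_trans (leeB IPle (LP_ge R b A0 lmin))).
rewrite lee_fin bE.
have Al : 0 < (A 0 l)%:~R :> R by rewrite ltr0z.
(* The move along the axis costs [c l * k] in both programs and cancels. *)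
have -> : ratr (c 0 l) / (A 0 l)%:~R * (b' + k * A 0 l)%:~R =
    ratr (c 0 l) / (A 0 l)%:~R * b'%:~R + ratr (c 0 l) * k%:~R :> R.
  by rewrite rmorphD rmorphM/=; field; rewrite gt_eqF.
have cl : `|ratr (c 0 l)| <= ratr (norm1 c) :> R.
  rewrite -ratr_norm ler_rat /norm1 (bigD1 l)//= ler_wpDr//.
  by rewrite sumr_ge0.
have Al_m : m%:R <= (A 0 l)%:~R :> R by rewrite -[m%:R]/(m%:~R) ler_int.
have mR : 0 < m%:R :> R by rewrite ltr0n.
have b'R : 0 <= b'%:~R :> R by rewrite ler0z.
(* The integer cost of [b'] and the opposite of its linear bound are each at most [|c|_1 b' / m],
   whence the factor 2. *)
have H1 := cost_le R c m0 mA xP.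
have H2 : - (ratr (c 0 l) / (A 0 l)%:~R * b'%:~R) <=
    ratr (norm1 c) * (b'%:~R / m%:R) :> R.
  rewrite -mulrA -mulNr; apply: (@le_trans _ _ (ratr (norm1 c) * ((A 0 l)%:~R^-1 * b'%:~R))).
    by rewrite ler_wpM2r ?mulr_ge0 ?invr_ge0 ?(ltW Al)// (le_trans _ cl)// -normrN ler_norm.
  rewrite ler_wpM2l ?(le_trans _ cl)// [leRHS]mulrC ler_wpM2r// lef_pV2 ?posrE//.
have H3 : ratr (norm1 c) * (b'%:~R / m%:R) <=
    ratr (norm1 c) * ((F%:R + (norm_inf A)%:~R) / m%:R) :> R.
  rewrite ler_wpM2l ?(le_trans _ cl)// ler_wpM2r ?invr_ge0 ?(ltW mR)//.
  by rewrite -[F%:R]/(F%:~R) -rmorphD ler_int.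
rewrite (_ : _ * (2 * _ / _) = ratr (norm1 c) * ((F%:R + (norm_inf A)%:~R) / m%:R) +
   ratr (norm1 c) * ((F%:R + (norm_inf A)%:~R) / m%:R)); last by field; rewrite gt_eqF.
lra.
Qed.

Lemma max_normalized_gap_le (R : realType) (n m F : nat) (eps : R)
    (A : 'rV[int]_n) :
  (0 < m)%N -> (forall i, m%:Z <= A 0 i) ->
  (forall b : nat, (F <= b)%N -> IP_feasible A b) ->
  (max_normalized_gap eps A <=
    (2 * (F%:R + (norm_inf A)%:~R) / m%:R * (norm_inf A)%:~R `^ (- eps))%:E)%E.
Proof.
move=> m0 mA hF; apply: ge_ereal_sup => _ [c /= c0 <-].
have n0 : (0 < n)%N.
  by case: n c {A mA hF} c0 => // c /eqP[]; apply/rowP; case.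
have c1 : 0 < ratr (norm1 c) :> R.
  rewrite ltr0q lt_def sumr_ge0// andbT; apply: contra c0.
  rewrite psumr_eq0// => /allP c0; apply/eqP/rowP => j; rewrite mxE.
  by have := c0 j (mem_index_enum _); rewrite normr_eq0 => /eqP.
have A0 : 0 < (norm_inf A)%:~R :> R.
  rewrite ltr0z (lt_le_trans _ (le_norm_inf A (Ordinal n0)))//.
  by rewrite (lt_le_trans _ (mA _)).
have A0e : 0 < (norm_inf A)%:~R `^ eps :> R by rewrite powR_gt0.
have -> : 2 * (F%:R + (norm_inf A)%:~R) / m%:R * (norm_inf A)%:~R `^ (- eps) =
   (ratr (norm1 c) * (2 * (F%:R + (norm_inf A)%:~R) / m%:R)) *
   ((norm_inf A)%:~R `^ eps * ratr (norm1 c))^-1 :> R.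
  by rewrite powRN; field; rewrite !gt_eqF ?ltr0n.
rewrite EFinM; apply: lee_wpmul2r.
  by rewrite lee_fin invr_ge0 mulr_ge0 ?(ltW A0e) ?(ltW c1).
apply: ge_ereal_sup => _ [b /= [fb _] <-]; exact: IG_le.
Qed.

Definition row_of (n M : nat) (f : {ffun 'I_n -> 'I_M.+1}) : 'rV[int]_n :=
  \row_j (f j : nat)%:Z.

Lemma row_of_inj (n M : nat) : injective (@row_of n M).
Proof.
move=> f g /rowP fg; apply/ffunP => j; apply: val_inj.
by have := fg j; rewrite !mxE => -[].
Qed.

Lemma perm_fset_set_Q (R : realType) (n : nat) (T : R) : 0 <= T ->
  perm_eq (enum_fset (fset_set (Q n T)))
    [seq row_of f | f <- enum (primitive_vectors n `|Num.floor T|%N)].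
Proof.
move=> T0; set M := `|Num.floor T|%N.
have ME : M%:Z = Num.floor T by rewrite gez0_abs// floor_ge0.
have gcdE (f : {ffun 'I_n -> 'I_M.+1}) :
    \big[gcdz/0]_j row_of f 0 j = (\big[gcdn/0%N]_j (f j : nat))%:Z.
  rewrite (big_morph Posz (id1 := 0) (op1 := gcdz) _ _)//.
  by apply: eq_bigr => j _; rewrite mxE.
apply: uniq_perm; rewrite ?fset_uniq ?(map_inj_uniq (@row_of_inj _ _)) ?enum_uniq//.
move=> A; rewrite in_fset_set; last exact: finite_Q.
apply/idP/mapP => [/set_mem[A0 A1 AT]|[f]].
  have AM j : (absz (A 0%R j) < M.+1)%N.
    rewrite ltnS -lez_nat gtz0_abs// ME (le_trans (le_norm_inf A j))//.
    by rewrite floor_ge_int.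
  exists [ffun j => Ordinal (AM j)]; last first.
    by apply/rowP => j; rewrite mxE ffunE/= gtz0_abs.
  rewrite mem_enum inE; apply/andP; split.
    by apply/forallP => j; rewrite ffunE/= absz_gt0 gt_eqF.
  rewrite -eqz_nat -gcdE; apply/eqP; transitivity (\big[gcdz/0]_(j < n) A 0 j).
    2: exact: A1.
  apply: eq_bigr => j _.
  by rewrite mxE ffunE/= gtz0_abs.
rewrite mem_enum inE => /andP[/forallP f0 /eqP f1] ->; apply/mem_set; split.
- by move=> j; rewrite mxE ltz_nat.
- by rewrite gcdE f1.
- rewrite -floor_ge_int -ME /norm_inf; apply: bigmax_le => // j _.
  by rewrite mxE ger0_norm// lez_nat -ltnS.
Qed.

Lemma N_E (R : realType) (n : nat) (T : R) : 0 <= T ->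
  N n T = #|primitive_vectors n `|Num.floor T|%N|.
Proof.
by move=> T0; rewrite /N (perm_size (perm_fset_set_Q n T0)) size_map -cardE.
Qed.

(** A combination [S] of the other entries congruent to [b] satisfies [S <= d * Y * s <= b], so
    [b - S] is a nonnegative multiple of [a i]. *)
Lemma feasible_of_cover (d : nat) (a : 'I_d.+1 -> nat) (i : 'I_d.+1) (Y s : nat) :
  (0 < a i)%N -> (forall j, a j <= s)%N ->
  (forall b, exists2 y : 'I_d -> nat, (forall j, y j <= Y)%N &
    (\sum_j a (lift i j) * y j = b %[mod a i])%N) ->
  forall b : nat, (d * Y * s <= b)%N -> IP_feasible (\row_j (a j)%:Z) b.
Proof.
move=> ai0 as_ cov b bF; have [y yY yb] := cov b.
set S := (\sum_j _)%N in yb.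
have Sb : (S <= b)%N.
  apply: leq_trans bF; rewrite -mulnA -[X in (X * (_ * _))%N]card_ord -sum_nat_const.
  by apply: leq_sum => j _; rewrite mulnC leq_mul.
have /dvdnP[k kE] : (a i %| b - S)%N by rewrite -eqn_mod_dvd//; apply/eqP.
exists (\col_j (oapp y k (unlift i j))%:Z); apply/IP_pointsE; split; last first.
  by move=> j; rewrite mxE.
rewrite (bigD1_ord i)//= !mxE unlift_none/=.
under eq_bigr do rewrite !mxE liftK/= -PoszM.
rewrite -(big_morph Posz PoszD (erefl _)) -/S -PoszM -PoszD; congr Posz.
by rewrite mulnC -kE subnK.
Qed.

Lemma max_gap_cover_le (R : realType) (d : nat) (a : 'I_d.+1 -> nat)
    (i : 'I_d.+1) (Y : nat) (eps : R) :
  let A := \row_j (a j)%:Z in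
  (0 < a i)%N -> (forall j, a i <= a j)%N ->
  (forall b, exists2 y : 'I_d -> nat, (forall j, y j <= Y)%N &
    (\sum_j a (lift i j) * y j = b %[mod a i])%N) ->
  (max_normalized_gap eps A <=
     (2 * (d * Y).+1%:R / (a i)%:R * (norm_inf A)%:~R `^ (1 - eps))%:E)%E.
Proof.
move=> A ai0 amin cov.
have aA j : (a j)%:Z <= norm_inf A by rewrite (le_trans _ (le_norm_inf A j))// mxE.
have A0 : 0 < norm_inf A by rewrite (lt_le_trans _ (aA i)).
pose s := `|norm_inf A|%N; have sE : norm_inf A = s%:Z by rewrite gtz0_abs.
have as_ j : (a j <= s)%N by rewrite -lez_nat -sE.
have := @max_normalized_gap_le R _ (a i) (d * Y * s) eps A ai0 _
  (feasible_of_cover ai0 as_ cov).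
move=> /(_ (fun j => ltac:(rewrite mxE lez_nat; exact: amin))) /le_trans; apply.
rewrite lee_fin sE -[s%:~R]/(s%:R); have s0 : 0 < s%:R :> R.
  by rewrite ltr0n -ltz_nat -sE.
rewrite powRD; last by rewrite (gt_eqF s0) implybT.
rewrite powRr1 ?ler0n// -natr1 !natrM le_eqVlt; apply/orP; left; apply/eqP.
by field; rewrite gt_eqF ?ltr0n.
Qed.

(** * Averaging *)

(* Minimizing [T m / K^(n - 1) + K T / m], the sum of the contributions of the
   resonant vectors (weighted by their proportion) and of the other ones, leads
   to [K] of order [m^(2/n)]. *)
Definition box_scale (R : realType) (n m : nat) : R := m%:R `^ (2 / n%:R).

Definition freq_radius (R : realType) (n m : nat) : nat :=
  Num.truncn (m%:R / box_scale R n m).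

(** With [U] the radius and [K] this side, [16 (U - 1) (K - 1) <= m <= 16 U K]: the kernel stays
    large on the box, which still has enough points. *)
Definition box_side (R : realType) (n m : nat) : nat :=
  (m %/ (16 * freq_radius R n m)).+1.

Lemma box_scale_ge1 (R : realType) (n m : nat) :
  (0 < m)%N -> 1 <= box_scale R n m.
Proof.
move=> m0; rewrite /box_scale -[leLHS](powRr0 m%:R) ler_powR ?ler1n//.
Qed.

Lemma box_scale_le (R : realType) (n m : nat) :
  (1 < n)%N -> (0 < m)%N -> box_scale R n m <= m%:R.
Proof.
move=> n1 m0; rewrite ler1_powR ?ler1n//.
by rewrite ler_pdivrMr ?mul1r ?ler_nat// ltr0n ltnW.
Qed.

Lemma box_scaleX (R : realType) (n m : nat) :
  (0 < n)%N -> box_scale R n m ^+ n = m%:R ^+ 2.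
Proof.
move=> n0; rewrite /box_scale -[LHS]powR_mulrn ?powR_ge0// -powRrM divfK ?pnatr_eq0 -?lt0n//.
by rewrite powR_mulrn// ler0n.
Qed.

Lemma freq_radius_bounds (R : realType) (n m : nat) : (1 < n)%N -> (0 < m)%N ->
  [/\ (0 < freq_radius R n m <= m)%N,
      (freq_radius R n m)%:R <= m%:R / box_scale R n m &
      m%:R / box_scale R n m <= 2 * (freq_radius R n m)%:R].
Proof.
move=> n1 m0; have w1 := box_scale_ge1 R n m0; have wm := box_scale_le R n1 m0.
have w0 : 0 < box_scale R n m by rewrite (lt_le_trans _ w1).
have q1 : 1 <= m%:R / box_scale R n m by rewrite ler_pdivlMr// mul1r.
have q0 := le_trans ler01 q1.
have /andP[Ule Ugt] := truncn_itv q0; rewrite -/(freq_radius R n m) in Ule Ugt.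
have U0 : (0 < freq_radius R n m)%N by rewrite truncn_gt0.
split=> //.
  rewrite U0/= -(ler_nat R) (le_trans Ule)// ler_pdivrMr//.
  by rewrite ler_peMr// ler0n.
apply: ltW (lt_le_trans Ugt _).
by rewrite -natr1 mulr_natl mulr2n lerD2l ler1n.
Qed.

Lemma box_side_bounds (R : realType) (n m : nat) : (1 < n)%N -> (0 < m)%N ->
  let U := freq_radius R n m in let K := box_side R n m in
  [/\ (K <= m)%N, (16 * (U.-1 * K.-1) <= m)%N, (m <= 16 * (U * K))%N &
      K%:R <= 2 * box_scale R n m].
Proof.
move=> n1 m0 U K; have [/andP[U0 Um] UR U2] := freq_radius_bounds R n1 m0.
rewrite -/U in U0 Um UR U2.
have D := leq_trunc_div m (16 * U); have D' := ltn_ceil m (_ : 0 < 16 * U)%N.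
have {}D' : (m < K * (16 * U))%N by apply: D'; lia.
have KE : (K = (m %/ (16 * U)).+1)%N by [].
split.
- have : (m %/ (16 * U) <= m %/ 16)%N by rewrite leq_div2l// leq_pmulr.
  rewrite KE; lia.
- rewrite KE /=; apply: leq_trans D.
  by rewrite mulnA mulnC !leq_mul2l leq_pred !orbT.
- lia.
- have w1 := box_scale_ge1 R n m0.
  have w0 : 0 < box_scale R n m by rewrite (lt_le_trans _ w1).
  rewrite KE -natr1; have UR0 : 0 < U%:R :> R by rewrite ltr0n.
  have : (m %/ (16 * U))%:R <= box_scale R n m; last by lra.
  rewrite -(ler_pM2r UR0); apply: (@le_trans _ _ (m%:R / 2)).
    rewrite ler_pdivlMr// -!natrM ler_nat; apply: leq_trans D.
    by rewrite -mulnA leq_mul2l [(U * 2)%N]mulnC leq_mul2r !orbT.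
  move: U2; rewrite ler_pdivrMr//; lra.
Qed.

Lemma trivial_cover (d m : nat) (a : 'I_d -> nat) : (0 < m)%N ->
  coprime m (\big[gcdn/0%N]_j a j) ->
  forall b, exists2 y : 'I_d -> nat, (forall j, y j <= m.-1)%N &
    (\sum_j a j * y j = b %[mod m])%N.
Proof.
move=> m0 co b; have [c cP] := coprime_Bezout co.
have mz : (m%:Z != 0) by rewrite eqz_nat -lt0n.
exists (fun j => absz (modz (c j * b%:Z) m)).
  move=> j; have := ltz_pmod (c j * b%:Z) (_ : 0 < m%:Z); have := modz_ge0 (c j * b%:Z) mz.
  by move=> ? /(_ m0); lia.
apply/eqP; rewrite -eqz_nat -!modz_nat eqz_mod_dvd.
rewrite (big_morph Posz PoszD (erefl _)).
have -> : \sum_j (a j * `|(c j * b%:Z %% m)%Z|)%N%:Z - b%:Z =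
    (\sum_j (a j)%:Z * c j - 1) * b%:Z - (\sum_j (a j)%:Z * (c j * b%:Z %/ m)%Z) * m%:Z.
  rewrite mulrBl mul1r addrAC; congr (_ - _).
  rewrite !mulr_suml -sumrB; apply: eq_bigr => j _.
  rewrite PoszM gez0_abs ?modz_ge0// /modz; lia.
by apply: rpredB; [exact: dvdz_mulr|exact: dvdz_mull].
Qed.

(** A resonant vector uses [Y = m - 1], for which [2 (d Y + 1) / m <= 2 n]. Any other uses
    [Y = 6 q K] with [q = 64 ^ d + 1] and [K] at most twice [box_scale], whence the 12. *)
Lemma gap_vector_le (R : realType) (d M : nat) (a : 'I_d.+1 -> nat)
    (i : 'I_d.+1) (eps : R) :
  let A := \row_j (a j)%:Z in let n := d.+1 in let m := a i in
  (0 < d)%N -> 2 / n%:R < eps -> (0 < a i)%N -> (forall j, a i <= a j)%N ->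
  (forall j, a j <= M)%N ->
  coprime m (\big[gcdn/0%N]_j a (lift i j)) ->
  (max_normalized_gap eps A <=
     (M%:R `^ (1 - 2 / n%:R) *
      (2 * n%:R * (resonant m (freq_radius R n m) (fun j => a (lift i j)))%:R
       + 2 * (12 * d * (64 ^ d).+1).+1%:R * (box_scale R n m / m%:R)))%:E)%E.
Proof.
move=> A n m d0 epsn m0 amin aM co.
have n1 : (1 < n)%N by rewrite ltnS.
have w1 := box_scale_ge1 R n m0.
have w0 : 0 < box_scale R n m by rewrite (lt_le_trans _ w1).
have mR : 0 < m%:R :> R by rewrite ltr0n.
have A1 : 1 <= (norm_inf A)%:~R :> R.
  by rewrite ler1z (le_trans _ (le_norm_inf A i))// mxE.
have AM : (norm_inf A)%:~R <= M%:R :> R.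
  rewrite -[M%:R]/(M%:~R) ler_int /norm_inf; apply: bigmax_le => // j _.
  by rewrite mxE ger0_norm// lez_nat.
set P := M%:R `^ _; have P0 : 0 <= P by exact: powR_ge0.
(* As [|A| >= 1], the exponent may be raised to [1 - 2 / n], which is nonnegative and so allows
   [|A| <= M]. *)
have nA : (norm_inf A)%:~R `^ (1 - eps) <= P.
  apply: (@le_trans _ _ ((norm_inf A)%:~R `^ (1 - 2 / n%:R))).
    by apply: ler_powR => //; rewrite lerD2l lerN2 ltW.
  apply: ge0_ler_powR; rewrite ?nnegrE ?ler0n//; last by rewrite (le_trans ler01).
  by rewrite subr_ge0 ler_pdivrMr ?ltr0n// mul1r ler_nat.
case: (boolP (resonant _ _ _)) => res.
  have cov := trivial_cover m0 co.
  apply: (le_trans (max_gap_cover_le eps m0 amin cov)); rewrite lee_fin mulr1.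
  rewrite [leRHS]mulrC; apply: ler_pM => //; rewrite ?powR_ge0 ?divr_ge0//.
  apply: ler_wpDr; first by rewrite mulr_ge0 ?divr_ge0 ?ltW.
  rewrite ler_pdivrMr// -mulrA ler_wpM2l// -natrM ler_nat /n -/m.
  by move: m0; rewrite -/m; nia.
have [Km UK mUK K2] := box_side_bounds R n1 m0.
have [Um _ _] := freq_radius_bounds R n1 m0.
have [z zP z8] := exists_prim_root_near1 R m0.
have cS := card_residues zP z8 UK mUK Um Km res.
move: cS; set S := #|_| => cS.
have S0 : (0 < S)%N.
  by rewrite lt0n; apply: contraL cS => /eqP ->; rewrite muln0 -ltnNge.
have mS : (m < (64 ^ d).+1 * S)%N by rewrite (leq_ltn_trans cS)// ltn_pmul2r.
have cov := box_covers m0 (ltn0Sn _ : 0 < box_side R n m)%N (coprime_Bezout co) mS.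
apply: (le_trans (max_gap_cover_le eps m0 amin cov)); rewrite lee_fin mulr0 add0r.
rewrite [leRHS]mulrC; apply: ler_pM => //; rewrite ?powR_ge0 ?divr_ge0//.
rewrite [box_scale _ _ _ / _]mulrC mulrA [leRHS]mulrAC ler_wpM2r ?invr_ge0 ?(ltW mR)//.
rewrite -mulrA ler_wpM2l// -natr1 -[in leRHS]natr1 mulrDl mul1r lerD//.
rewrite (_ : d * _ = 6 * d * (64 ^ d).+1 * box_side R n m)%N; last first.
  by rewrite mulnA [(d * _)%N]mulnA [(d * 6)%N]mulnC.
rewrite natrM (le_trans (ler_wpM2l _ K2))// mulrA ler_wpM2r ?(ltW w0)//.
by rewrite -natrM ler_nat; move: (64 ^ d).+1 => q; rewrite mulnC !mulnA.
Qed.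

(** With [y k = k ^ (1 / n)], [box_scale] is [y ^ 2], and [1 = y m.+1 ^ n - y m ^ n] is at most
    [n y m.+1 ^ (n - 1) (y m.+1 - y m)]. The right-hand side telescopes over [m]. *)
Lemma box_scale_div_le (R : realType) (n m : nat) : (0 < n)%N ->
  box_scale R n m.+1 / m.+1%:R <= n%:R * (box_scale R n m.+1 - box_scale R n m).
Proof.
move=> n0; have nR : n%:R != 0 :> R by rewrite pnatr_eq0 -lt0n.
pose y (k : nat) : R := k%:R `^ n%:R^-1.
have y0 k : 0 <= y k by exact: powR_ge0.
have yX k : y k ^+ n = k%:R.
  by rewrite /y -powR_mulrn ?powR_ge0// -powRrM mulVf// powRr1// ler0n.
have sE k : box_scale R n k = y k ^+ 2.
  by rewrite /y -powR_mulrn ?powR_ge0// -powRrM mulrC.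
have ylt : y m <= y m.+1.
  by apply: ge0_ler_powR; rewrite ?nnegrE ?invr_ge0 ?ler0n// ler_nat.
have y1 : 0 < y m.+1 by rewrite powR_gt0 ?ltr0n.
have H : 1 <= (y m.+1 - y m) * (n%:R * y m.+1 ^+ n.-1).
  have E1 : y m.+1 ^+ n - y m ^+ n = 1 by rewrite !yX -natrB// subSnn.
  rewrite -[leLHS]E1 subrXX ler_wpM2l ?subr_ge0//.
  apply: (@le_trans _ _ (\sum_(i < n) y m.+1 ^+ n.-1)); last first.
    by rewrite sumr_const card_ord mulr_natl.
  apply: ler_sum => i _.
  have iN : (i <= n.-1)%N by have := ltn_ord i; lia.
  rewrite -[X in _ <= _ ^+ X](subnK iN) exprD.
  by rewrite ler_wpM2l ?exprn_ge0// lerXn2r ?nnegrE.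
have yS : y m.+1 ^+ n = y m.+1 * y m.+1 ^+ n.-1 by rewrite -exprS prednK.
rewrite !sE -[m.+1%:R]yX yS ler_pdivrMr ?mulr_gt0 ?exprn_gt0//.
have yn0 : 0 <= y m.+1 ^+ n.-1 by rewrite exprn_ge0.
apply: (@le_trans _ _ (y m.+1 ^+ 2 * ((y m.+1 - y m) * (n%:R * y m.+1 ^+ n.-1)))).
  by rewrite ler_peMr ?exprn_ge0.
have -> : n%:R * (y m.+1 ^+ 2 - y m ^+ 2) * (y m.+1 * y m.+1 ^+ n.-1) =
  y m.+1 ^+ 2 * ((y m.+1 - y m) * (n%:R * y m.+1 ^+ n.-1)) +
  n%:R * y m * y m.+1 * (y m.+1 - y m) * y m.+1 ^+ n.-1 by ring.
by rewrite lerDl !mulr_ge0 ?subr_ge0.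
Qed.

Lemma sum_box_scale_div_le (R : realType) (n M : nat) : (0 < n)%N ->
  \sum_(m < M.+1 | (0 < m)%N) box_scale R n m / m%:R <= n%:R * box_scale R n M.
Proof.
move=> n0; rewrite big_mkcond big_ord_recl /= add0r.
under eq_bigr do rewrite /= /bump add1n.
elim: M => [|M IH]; first by rewrite big_ord0 mulr_ge0 ?powR_ge0.
rewrite big_ord_recr/=.
have := box_scale_div_le R M n0.
by rewrite mulrBr lerBrDl; apply: le_trans; rewrite lerD2r.
Qed.

(** The bound of [gap_vector_le] without its power of [M], for any position [i]: summing over all
    [i] avoids tracking where the minimum is attained. *)
Definition vector_weight (R : realType) (d M : nat)
    (f : {ffun 'I_d.+1 -> 'I_M.+1}) (i : 'I_d.+1) : R :=
  2 * d.+1%:R *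
    (resonant (f i) (freq_radius R d.+1 (f i)) (fun j => f (lift i j)))%:R
  + 2 * (12 * d * (64 ^ d).+1).+1%:R * (box_scale R d.+1 (f i) / (f i)%:R).

Lemma card_fiber (d M : nat) (i : 'I_d.+1) (m : 'I_M.+1)
    (P : pred {ffun 'I_d -> 'I_M.+1}) :
  (#|[set f : {ffun 'I_d.+1 -> 'I_M.+1} |
      (f i == m) && P [ffun j : 'I_d => f (lift i j)]]|
    <= #|P|)%N.
Proof.
pose r (f : {ffun 'I_d.+1 -> 'I_M.+1}) : {ffun 'I_d -> 'I_M.+1} :=
  [ffun j : 'I_d => f (lift i j)].
rewrite -(@card_in_imset _ _ r); last first.
  move=> f g; rewrite !inE => /andP[/eqP fi _] /andP[/eqP gi _] /ffunP fg.
  apply/ffunP => j; case: (unliftP i j) => [k ->|->]; last by rewrite fi gi.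
  by have := fg k; rewrite !ffunE.
apply: subset_leq_card; apply/subsetP => g /imsetP[f]; rewrite !inE.
by move=> /andP[_ Pf] ->.
Qed.

(** For fixed [i], sort the vectors by [m = f i]: each [m] contributes [O(M ^ d box_scale m / m)].
    The sums over [m] and over [i] give a factor [n] each. *)
Lemma sum_vector_weight (R : realType) (d M : nat) : (0 < d)%N -> (0 < M)%N ->
  \sum_(f in primitive_vectors d.+1 M) \sum_i vector_weight R f i <=
  (2 * d.+1%:R * 8 ^+ d + 2 * (12 * d * (64 ^ d).+1).+1%:R * 2 ^+ d) * d.+1%:R ^+ 2 *
    (M%:R ^+ d * box_scale R d.+1 M).
Proof.
move=> d0 M0; set n := d.+1; set C1 := 2 * n%:R; set C2 := 2 * (_).+1%:R.
have n1 : (1 < n)%N by rewrite ltnS.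
have MR : 0 < M%:R :> R by rewrite ltr0n.
have C10 : 0 <= C1 by rewrite mulr_ge0.
have C20 : 0 <= C2 by rewrite mulr_ge0.
set E := primitive_vectors n M.
rewrite exchange_big /=.
set C := C1 * 8 ^+ d + C2 * 2 ^+ d.
have C0 : 0 <= C by rewrite addr_ge0 ?mulr_ge0 ?exprn_ge0.
suff H i : \sum_(f in E) vector_weight R f i <= C * n%:R * (M%:R ^+ d * box_scale R n M).
  apply: (le_trans (ler_sum _ (fun i _ => H i))).
  rewrite sumr_const card_ord -[leLHS]mulr_natr mulrAC.
  by rewrite expr2 -!mulrA.
have -> : \sum_(f in E) vector_weight R f i =
    \sum_(m < M.+1 | (0 < m)%N) \sum_(f in E | f i == m) vector_weight R f i.
  apply: partition_big => f; rewrite inE => /andP[/forallP f0 _]; exact: f0.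
apply: (@le_trans _ _ (\sum_(m < M.+1 | (0 < m)%N)
    C * M%:R ^+ d * (box_scale R n m / m%:R))); last first.
  rewrite -mulr_sumr; have := sum_box_scale_div_le R M (ltnW n1).
  move=> /(ler_wpM2l (mulr_ge0 C0 (exprn_ge0 d (ltW MR)))) /le_trans; apply.
  by rewrite -!mulrA ler_wpM2l// mulrCA.
apply: ler_sum => m m0.
have mR : 0 < m%:R :> R by rewrite ltr0n.
have w1 := box_scale_ge1 R n m0.
have w0 : 0 < box_scale R n m by rewrite (lt_le_trans _ w1).
have mM : (0 < m <= M)%N by rewrite m0 -ltnS ltn_ord.
have [/andP[U0 Um] UR _] := freq_radius_bounds R n1 m0.
set U := freq_radius R n m in U0 Um UR.
pose bad (g : {ffun 'I_d -> 'I_M.+1}) :=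
  resonant m U (fun j => g j) && coprime m (\big[gcdn/0%N]_j (g j : nat)).
pose rest (f : {ffun 'I_n -> 'I_M.+1}) : {ffun 'I_d -> 'I_M.+1} :=
  [ffun j : 'I_d => f (lift i j)].
have -> : \sum_(f in E | f i == m) vector_weight R f i =
   C1 * (\sum_(f in E | f i == m) (bad (rest f))%:R) +
   \sum_(f in E | f i == m) C2 * (box_scale R n m / m%:R).
  rewrite mulr_sumr -big_split; apply: eq_bigr => f /andP[fE /eqP fi] /=.
  rewrite /vector_weight fi; congr (_ * (_ : bool)%:R + _).
  have restE : (fun j => (rest f j : nat)) = (fun j => (f (lift i j) : nat)).
    by apply/funext => j; rewrite ffunE.
  (* For a primitive [f], the entry [f i] is coprime to the gcd of the others, as [bad] demands. *)
  rewrite /bad restE -/U; have -> : coprime m (\big[gcdn/0%N]_j (rest f j : nat)).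
    move: fE; rewrite inE => /andP[_]; rewrite (bigD1_ord i)//= fi.
    by rewrite /coprime; under [X in _ -> gcdn _ X == _]eq_bigr do rewrite ffunE.
  by rewrite andbT.
rewrite /C -[leRHS]mulrA [leRHS]mulrDl; apply: lerD.
  rewrite -!mulrA !ler_wpM2l//.
  have cb : \sum_(f in E | f i == m) (bad (rest f))%:R <=
      (#|bad|)%:R :> R.
    rewrite -natr_sum ler_nat; apply: leq_trans (card_fiber i m bad).
    rewrite -sum1_card big_mkcond [leqRHS]big_mkcond; apply: leq_sum => f _ /=.
    by case: (f \in E) => //=; rewrite inE; case: (f i == m) => //=.
  apply: (le_trans cb).
  have := card_resonant d mM Um; rewrite cardsE -/bad => H.
  have {}H : m%:R ^+ d * (#|bad|)%:R <= m%:R * (8 * U%:R * M%:R) ^+ d :> R.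
    by rewrite -!natrM -!natrX -!natrM ler_nat.
  rewrite -(ler_pM2l (exprn_gt0 d mR)) (le_trans H)//.
  apply: (@le_trans _ _ (m%:R * (8 * (m%:R / box_scale R n m) * M%:R) ^+ d)).
    rewrite ler_wpM2l// lerXn2r ?nnegrE ?mulr_ge0 ?invr_ge0 ?(ltW w0)//.
    by rewrite ler_wpM2r// ler_wpM2l.
  have sX : box_scale R n m * box_scale R n m ^+ d = m%:R ^+ 2.
    by rewrite -exprS; exact: box_scaleX.
  have wd0 : 0 < box_scale R n m ^+ d by rewrite exprn_gt0.
  rewrite !exprMn exprVn le_eqVlt; apply/orP; left; apply/eqP.
  (* The resonant proportion reaches the order of the other term because [box_scale ^ n = m ^ 2]. *)
  have E1 : m%:R / box_scale R n m ^+ d = box_scale R n m / m%:R :> R.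
    by apply/eqP; rewrite eqr_div ?(gt_eqF wd0) ?(gt_eqF mR)// sX expr2.
  rewrite -E1; move: wd0; set W := _ ^+ d => W0.
  by move: (8 ^+ d) (m%:R ^+ d) (M%:R ^+ d) => x y t; field; rewrite gt_eqF.
rewrite sumr_const -[leLHS]mulr_natr -mulrA -[leRHS]mulrA ler_wpM2l//.
rewrite [leLHS]mulrC [leRHS]mulrA ler_wpM2r ?divr_ge0 ?(ltW w0)//.
rewrite -exprMn -natrM -natrX ler_nat.
apply: (@leq_trans (M.+1 ^ d)); last first.
  by case: (d) => // k; rewrite leq_exp2r//; lia.
have := card_fiber i m xpredT; rewrite card_ffun !card_ord.
apply: leq_trans; apply: subset_leq_card; apply/subsetP => f; rewrite !inE.
by move=> /andP[_ ->].
Qed.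

(** The position of a smallest entry is among the [i], and the other weights are nonnegative. *)
Lemma gap_primitive_vector_le (R : realType) (d M : nat) (eps : R)
    (f : {ffun 'I_d.+1 -> 'I_M.+1}) :
  (0 < d)%N -> 2 / d.+1%:R < eps -> f \in primitive_vectors d.+1 M ->
  (max_normalized_gap eps (row_of f) <=
    (M%:R `^ (1 - 2 / d.+1%:R) * \sum_i vector_weight R f i)%:E)%E.
Proof.
move=> d0 epsn; rewrite inE => /andP[/forallP f0 f1].
have [i fmin] : exists i, forall j, (f i <= f j)%N.
  case: (@arg_minnP _ ord0 xpredT (fun j => f j : nat)) => // i _ H.
  by exists i => j; exact: H.
have co : coprime (f i) (\big[gcdn/0%N]_j (f (lift i j) : nat)).
  by move: f1; rewrite (bigD1_ord i).
have fM j : (f j <= M)%N by rewrite -ltnS.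
apply: (le_trans (gap_vector_le d0 epsn (f0 i) fmin fM co)).
rewrite lee_fin ler_wpM2l ?powR_ge0// (bigD1 i)//= lerDl sumr_ge0// => j _.
by rewrite /vector_weight /box_scale addr_ge0// !mulr_ge0 ?invr_ge0 ?powR_ge0.
Qed.

Local Open Scope classical_set_scope.

Theorem corollary4 (R : realType) (n : nat) (hn : (3 <= n)%N) :
  exists C : R, 0 < C /\
    forall eps T : R, 2 / n%:R < eps -> 1 <= T ->
      (((N n T)%:R^-1)%:E *
        \sum_(A \in Q n T) max_normalized_gap eps A <= C%:E)%E.
Proof.
case: n hn => // d d2; have d0 : (0 < d)%N by exact: ltnW.
set C := (2 * d.+1%:R * 8 ^+ d + 2 * (12 * d * (64 ^ d).+1).+1%:R * 2 ^+ d) *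
  d.+1%:R ^+ 2 : R.
have C0 : 0 < C by rewrite /C !(mulr_gt0, addr_gt0, exprn_gt0).
(* The 4 accounts for the density of primitive vectors, at least one quarter. *)
exists (4 * C); split=> [|eps T epsn T1]; first by rewrite mulr_gt0.
have T0 : 0 <= T by exact: le_trans T1.
rewrite fsbig_finite; last exact: finite_Q.
rewrite (perm_big _ (perm_fset_set_Q d.+1 T0)) big_map big_enum N_E//.
set M := `|Num.floor T|%N; set E := primitive_vectors d.+1 M.
have M0 : (0 < M)%N by rewrite absz_gt0 gt_eqF// floor_gt0.
have MR : 0 < M%:R :> R by rewrite ltr0n.
apply: (@le_trans _ _ (((#|E|%:R)^-1)%:E * (\sum_(f in E)
    (M%:R `^ (1 - 2 / d.+1%:R) * \sum_i vector_weight R f i)%:E))%E).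
  apply: lee_wpmul2l; first by rewrite lee_fin invr_ge0.
  by apply: lee_sum => f fE; exact: gap_primitive_vector_le.
rewrite sumEFin -EFinM lee_fin -mulr_sumr.
have cE : (M ^ d.+1 <= 4 * #|E|)%N by apply: card_primitive_vectors; rewrite ltnS.
have E0 : 0 < #|E|%:R :> R.
  rewrite ltr0n; have : (0 < M ^ d.+1)%N by rewrite expn_gt0 M0.
  by move=> /leq_trans/(_ cE); rewrite muln_gt0.
rewrite ler_pdivrMl// (le_trans (ler_wpM2l (powR_ge0 _ _) (sum_vector_weight R d0 M0)))//.
rewrite -/C /box_scale.
(* The exponents of [M] add up to [(1 - 2 / n) + d + 2 / n = n]. *)
have -> : M%:R `^ (1 - 2 / d.+1%:R) * (C * (M%:R ^+ d * M%:R `^ (2 / d.+1%:R))) =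
    C * M%:R ^+ d.+1.
  rewrite mulrCA [M%:R `^ _ * _]mulrCA -powRD; last by rewrite (gt_eqF MR) implybT.
  by rewrite subrK powRr1// exprSr.
by rewrite mulrCA mulrC mulrA ler_wpM2r ?(ltW C0)// -natrX -natrM ler_nat.
Qed.
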